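(* Let $T>0$, let $\Omega\subset\mathbb{R}^N$ be a nonempty open set, and let $f=f(t,x)\colon [0,T]\times\Omega\to\mathbb{R}^N$ be continuous. Let $G$ be an open bounded set with $\overline{G}\subset\Omega$ strictly star-shaped with respect to all the points in a ball $B[p,\delta]\subset G$ (with $\delta>0$). Assume that for each $u\in \partial G$ there exists $\nu_{u}\in N_{\mathrm{B}}(u)$ such that $$\langle f(t,u),\nu_{u} \rangle \leq 0, \quad \text{for all } t\in [0,T].$$ Then there exists a $T$-periodic solution of $\dot{y}=f(t,y)$ with values in $\overline{G}$.
   Context: $\langle\cdot,\cdot\rangle$ is the Euclidean inner product; $B[p,\delta]$ is the closed Euclidean ball with center $p$ and radius $\delta$. For a nonempty open bounded set $A\subset\mathbb{R}^N$, $\overline{A}$ is strictly star-shaped with respect to a point $p\in A$ if for each $u\in\partial A$ one has $[p,u[\,\subset A$, where $[p,u[\,:=\{p+\vartheta(u-p)\colon 0\leq\vartheta<1\}$. Let $M:=\overline{G}$ and $u\in\partial M$. A vector $\nu\neq 0$ is an outer normal to $M$ in $u$ according to Bony if $u$ is a point of $M$ at minimal distance from $u+\lambda\nu$ for some $\lambda>0$. $N_{\mathrm{B}}(u)$ denotes the set of all Bony outer normals to $M=\overline{G}$ in $u$. (When $\overline{G}$ is strictly star-shaped, $\partial G=\partial\overline{G}$.) A $T$-periodic solution of $\dot y=f(t,y)$ with values in $\overline{G}$ is a solution $y$ defined on $[0,T]$ such that $y(0)=y(T)$ and $y(t)\in\overline{G}$ for all $t\in[0,T]$. Uniqueness of solutions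 of initial value problems is not assumed. *)

(* Defs.v *)
From HB Require Import structures.
From mathcomp Require Import all_boot all_order all_algebra.
From mathcomp Require Import all_classical all_reals all_analysis.

Set Implicit Arguments.
Unset Strict Implicit.
Unset Printing Implicit Defensive.
Import Order.TTheory GRing.Theory Num.Theory.
Import numFieldNormedType.Exports.

Local Open Scope classical_set_scope.
Local Open Scope ring_scope.

(* The library's norm on 'rV[R]_N is the sup norm. It induces the Euclidean
   topology and bounded sets, so it is used for those; distances and balls
   are taken with [enorm] below. *)

Definition inner (R : realType) (N : nat) (u v : 'rV[R]_N) : R :=
  \sum_(i < N) u ord0 i * v ord0 i.

Definition enorm (R : realType) (N : nat) (u : 'rV[R]_N) : R :=
  Num.sqrt (inner u u).

Definition eclosed_ball (R : realType) (N : nat) (p : 'rV[R]_N) (d : R) :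
    set 'rV[R]_N :=
  [set x | enorm (x - p) <= d].

Definition boundary (X : topologicalType) (A : set X) : set X :=
  closure A `\` interior A.

Definition segment_co (R : realType) (N : nat) (p u : 'rV[R]_N) :
    set 'rV[R]_N :=
  [set p + theta *: (u - p) | theta in `[(0 : R), 1[%classic].

(* "closure A is strictly star-shaped with respect to p": the notion is a
   property of the open set A itself. *)
Definition closure_strictly_star_shaped (R : realType) (N : nat)
    (A : set 'rV[R]_N) (p : 'rV[R]_N) : Prop :=
  A p /\ forall u, boundary A u -> segment_co p u `<=` A.

Definition bony_normals (R : realType) (N : nat) (M : set 'rV[R]_N)
    (u : 'rV[R]_N) : set 'rV[R]_N :=
  [set nu | nu != 0 /\
    exists2 lambda : R, 0 < lambda &
      M u /\ forall v, M v ->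
        enorm (u - (u + lambda *: nu)) <= enorm (v - (u + lambda *: nu))].

(* The limit is taken through s in [0, T], s <> t, so it is the one-sided
   derivative at the end points 0 and T. *)
Definition ode_solution (R : realType) (N : nat) (T : R)
    (f : R -> 'rV[R]_N -> 'rV[R]_N) (y : R -> 'rV[R]_N) : Prop :=
  forall t : R, t \in `[0, T] ->
    (s - t)^-1 *: (y s - y t) @[s --> within `[0, T]%classic t^'] --> f t (y t).

(* Main.v *)
(* The set of continuous curves with values in G is open and star-shaped around
   the constant p, so a Leray-Schauder continuation from y' = -(y - p) to
   y' = f(t, y) applies: along y' = w f(t, y) - (1 - w)(y - p) with w < 1, no
   periodic solution in the closure of G touches the boundary. Indeed, at a contact
   point u = y(t) the curve stays outside the open ball provided by the Bony normal
   nu, so its left derivative v satisfies <v, nu> >= 0, whereas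
   <f(t, u), nu> <= 0 < <u - p, nu>, the second inequality because G is star-shaped
   with respect to a whole ball around p.

   The degree is replaced by Brouwer's theorem on discretized problems: the space of
   cyclic polygons with n vertices is mapped into itself by one Euler step with a
   parameter w that depends on the polygon, vanishes unless all its vertices are in
   G, and is 1 as soon as they all have distance at least 1/n to the complement of
   G. Fixed points are periodic Euler polygons; their limit along an ultrafilter
   solves the equation with the limit value of w, and either w = 1 or the limit
   touches the boundary, which forces w = 1 as well.

   Brouwer's theorem comes from Kuhn's cubical lemma. A bit b_j on the vertices of
   the grid {0..k}^d, equal to 0 on the face x_j = 0 and to 1 on the face x_j = k, has
   a coboundary vanishing on these two faces; by Stokes' formula modulo 2 the cup
   product of the d coboundaries sums to 1 over the triangulated grid, so that in
   some cell all the bits change. *)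
Require Import Defs.
From HB Require Import structures.
From mathcomp Require Import all_boot all_order all_algebra.
From mathcomp Require Import all_classical all_reals all_analysis.
From mathcomp Require Import ring lra.
Import Order.TTheory GRing.Theory Num.Theory.
Import numFieldNormedType.Exports.
Local Open Scope classical_set_scope.
Local Open Scope ring_scope.

Set Implicit Arguments.
Unset Strict Implicit.
Unset Printing Implicit Defensive.

(** * Cochains modulo 2 and Kuhn's lemma *)

Lemma addF2xx (x : 'F_2) : x + x = 0.
Proof. by rewrite -mulr2n mulrn_pchar //; apply: pchar_Fp. Qed.

Lemma F2_eq1 (x : 'F_2) : x != 0 -> x = 1.
Proof. by case: x => [[|[|k]]] // hk _; apply/val_inj. Qed.

Section Cochains.
Variable T : Type.
Implicit Types (phi psi : seq T -> 'F_2) (s : seq T).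

(** The signs of the faces disappear modulo 2. The complex is augmented: on a single vertex the
    value is [phi [::]], whence the hypothesis [phi [::] = 0] in [grid_sum_coboundary_eq0]. *)
Fixpoint coboundary phi s : 'F_2 :=
  if s is x :: s' then phi s' + coboundary (fun t => phi (x :: t)) s' else 0.

(** Transpose of the prism operator of simplicial homology: the sum over [i] of [phi] on
    [a x_0, ..., a x_i, b x_i, ..., b x_n]. *)
Fixpoint prism (a b : T -> T) phi s : 'F_2 :=
  if s is x :: s' then
    phi (a x :: b x :: map b s') + prism a b (fun t => phi (a x :: t)) s'
  else 0.

Lemma coboundaryD phi psi s :
  coboundary (fun t => phi t + psi t) s = coboundary phi s + coboundary psi s.
Proof.
elim: s phi psi => [|x s ih] phi psi /=; first by rewrite addr0.
by rewrite ih; ring.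
Qed.

Lemma coboundaryZ c phi s :
  coboundary (fun t => c * phi t) s = c * coboundary phi s.
Proof.
elim: s phi => [|x s ih] phi /=; first by rewrite mulr0.
by rewrite ih; ring.
Qed.

Lemma coboundary_map (a : T -> T) phi s :
  coboundary (fun t => phi (map a t)) s = coboundary phi (map a s).
Proof. by elim: s phi => //= x s ih phi; rewrite (ih (fun t => phi (a x :: t))). Qed.

Lemma eq_prism a b phi psi s : phi =1 psi -> prism a b phi s = prism a b psi s.
Proof.
elim: s phi psi => //= x s ih phi psi e; rewrite e; congr (_ + _).
by apply: ih => t; rewrite e.
Qed.

Lemma prismD a b phi psi s :
  prism a b (fun t => phi t + psi t) s = prism a b phi s + prism a b psi s.
Proof.
elim: s phi psi => [|x s ih] phi psi /=; first by rewrite addr0.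
by rewrite ih; ring.
Qed.

(* The chain homotopy formula [d P + P d = b_* - a_*], modulo 2. *)
Lemma prism_coboundary a b phi s :
  prism a b (coboundary phi) s + coboundary (prism a b phi) s
  = phi (map a s) + phi (map b s).
Proof.
elim: s phi => [|x s ih] phi /=; first by rewrite addr0 addF2xx.
rewrite prismD coboundaryD -(coboundary_map b (fun t => phi (a x :: b x :: t))).
have h := ih (fun t => phi (a x :: t)).
have e := addF2xx.
set A := phi (b x :: _); set B := phi (a x :: map b s).
set C := coboundary _ _; set D := prism a b phi s; set E := prism a b _ s.
set F := coboundary _ s.
have -> : E = phi (a x :: map a s) + B - F by rewrite -h /E /F; ring.
set K := phi _.
have -> : A + (B + C) + (D + (K + B - F)) + (D + (C + F)) = 
   (K + A) + (B + B) + (C + C) + (D + D) by ring.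
by rewrite !e !addr0.
Qed.

(* [cup l g] is the cup product of the coboundaries of the 0-cochains in [l]
   with the 0-cochain [g]. *)
Fixpoint cup (l : seq (T -> 'F_2)) (g : T -> 'F_2) s : 'F_2 :=
  match l, s with
  | [::], [:: x] => g x
  | b :: l', x :: ((y :: _) as s') => (b x + b y) * cup l' g s'
  | _, _ => 0
  end.

Lemma coboundary0 s : coboundary (fun=> 0) s = 0.
Proof. by elim: s => //= x s ->; rewrite addr0. Qed.

(** Leibniz rule: the factors from [l] are coboundaries, hence cocycles, so only [g] is
    differentiated and becomes one more factor. *)
Lemma coboundary_cup l g s :
  coboundary (cup l g) s = cup (rcons l g) (fun=> 1) s.
Proof.
elim: l s => [|c l ih] [|x s] //.
  case: s => [|y [|z s]] /=.
  - by rewrite addr0.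
  - by rewrite !addr0 mulr1 addrC.
  - by rewrite mulr0 coboundary0 !addr0.
case: s => [|y [|z s]].
- by rewrite /= addr0.
- by rewrite /= !addr0; case: (l) => [|? ?] /=; rewrite mulr0.
have -> : cup (rcons (c :: l) g) (fun=> 1) [:: x, y, z & s] =
  (c x + c y) * cup (rcons l g) (fun=> 1) [:: y, z & s] by [].
rewrite -ih.
set K := cup l g.
have -> : coboundary (cup (c :: l) g) [:: x, y, z & s] =
  (c y + c z) * K (z :: s) + ((c x + c z) * K (z :: s)
   + coboundary (fun t => (c x + c y) * K (y :: t)) (z :: s)) by [].
rewrite coboundaryZ.
have -> : coboundary K [:: y, z & s] =
  K (z :: s) + coboundary (fun t => K (y :: t)) (z :: s) by [].
set A := K _; set B := coboundary _ _.
have -> : (c y + c z) * A + ((c x + c z) * A + (c x + c y) * B) =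
  (c x + c y) * (A + B) + (c z + c z) * A by ring.
by rewrite addF2xx mul0r addr0.
Qed.

Lemma eq_cup l g g' s : g =1 g' -> cup l g s = cup l g' s.
Proof.
move=> e; elim: l s => [|b l ih] [|x [|y s]] //=.
by rewrite ih.
Qed.

Lemma cup0 l s : cup l (fun=> 0) s = 0.
Proof. by elim: l s => [|b l ih] [|x [|y s]] //=; rewrite ih mulr0. Qed.

Lemma cup_const l g s i c : (i < size l)%N ->
  all (fun x => nth (fun=> 0) l i x == c) s -> cup l g s = 0.
Proof.
elim: l i s => [|b l ih] [|i] [|x [|y s]] //=.
  by move=> _ /and3P[/eqP-> /eqP-> _]; rewrite addF2xx mul0r.
by rewrite ltnS => il /and3P[_ hy hs]; rewrite (ih i) ?mulr0 //= hy.
Qed.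

Lemma prism_neq0 a b phi s (P Q : pred T) :
  (forall x, P x -> Q (a x) && Q (b x)) -> all P s -> prism a b phi s != 0 ->
  exists2 t, all Q t & phi t != 0.
Proof.
move=> PQ; elim: s phi => [|x s ih] phi /=; first by rewrite ?eqxx.
move=> /andP[Px Ps].
have [-> |h _] := eqVneq (phi (a x :: b x :: map b s)) 0.
  rewrite add0r => /(ih _ Ps)[t Qt ht]; exists (a x :: t) => //=.
  by have /andP[-> _] := PQ x Px.
exists (a x :: b x :: map b s) => //=; have /andP[-> ->] := PQ x Px.
by rewrite all_map; apply: sub_all Ps => y /PQ /andP[].
Qed.

Lemma prism_eq0 a b phi s (P Q : pred T) :
  (forall x, P x -> Q (a x) && Q (b x)) -> all P s ->
  (forall t, all Q t -> phi t = 0) -> prism a b phi s = 0.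
Proof.
move=> PQ Ps h; apply/eqP; apply: contraT => /(prism_neq0 PQ Ps)[t Qt].
by rewrite h ?eqxx.
Qed.
End Cochains.

Lemma cup_map (S T : Type) (a : S -> T) (l : seq (T -> 'F_2)) g s :
  cup l g (map a s) = cup [seq b \o a | b <- l] (g \o a) s.
Proof.
elim: l s => [|b l ih] [|x [|y s]] //=.
by rewrite -[a y :: map a s]/(map a (y :: s)) ih.
Qed.

(** * Stokes' formula on the triangulated grid *)

Section Grid.
Variable k : nat.

(** Vertices are functions on all of [nat], so that the grids of all dimensions share one type in
    the inductions. *)
Definition set_coord (d z : nat) (x : nat -> nat) : nat -> nat :=
  fun j => if j == d then z else x j.

(* Iterated prisms produce the standard triangulation of the grid [{0..k}^d], over
   whose simplices [phi] is summed. *)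
Fixpoint grid_sum (d : nat) (phi : seq (nat -> nat) -> 'F_2) : 'F_2 :=
  if d is d'.+1 then
    \sum_(z < k) grid_sum d' (prism (set_coord d' z) (set_coord d' z.+1) phi)
  else phi [:: fun=> 0%N].

Lemma eq_grid_sum d phi psi : phi =1 psi -> grid_sum d phi = grid_sum d psi.
Proof.
elim: d phi psi => [|d ih] phi psi e /=; first by apply: e.
by apply: eq_bigr => z _; apply: ih => s; apply: eq_prism.
Qed.

Lemma grid_sumD d phi psi :
  grid_sum d (fun s => phi s + psi s) = grid_sum d phi + grid_sum d psi.
Proof.
elim: d phi psi => [|d ih] phi psi //=; rewrite -big_split /=.
apply: eq_bigr => z _; rewrite -ih; apply: eq_grid_sum => s.
exact: prismD.
Qed.

(** Summed over the layers [z], [prism_coboundary] telescopes: interior layers cancel modulo 2 and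
    the two end faces remain. The lateral faces are carried by the last sum, a coboundary in
    dimension [d]. *)
Lemma grid_sum_coboundary d phi :
  grid_sum d.+1 (coboundary phi) =
    grid_sum d (fun s => phi (map (set_coord d 0) s))
    + grid_sum d (fun s => phi (map (set_coord d k) s))
    + \sum_(z < k) grid_sum d
        (coboundary (prism (set_coord d z) (set_coord d z.+1) phi)).
Proof.
pose I (z : nat) := grid_sum d (fun s => phi (map (set_coord d z) s)).
have e (z : nat) :
    grid_sum d (prism (set_coord d z) (set_coord d z.+1) (coboundary phi)) =
    I z + I z.+1 + grid_sum d
        (coboundary (prism (set_coord d z) (set_coord d z.+1) phi)).
  rewrite /I -!grid_sumD; apply: eq_grid_sum => s.
  by rewrite -prism_coboundary -addrA addF2xx addr0.
rewrite /= (eq_bigr _ (fun (z : 'I_k) _ => e z)) big_split /=; congr (_ + _).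
suff tel m : \sum_(z < m) (I z + I z.+1) = I 0%N + I m by exact: tel.
elim: m => [|m ih]; first by rewrite big_ord0 addF2xx.
by rewrite big_ord_recr /= ih addrA -(addrA (I 0%N)) addF2xx addr0.
Qed.

Lemma grid_sum0 d : grid_sum d (fun=> 0) = 0.
Proof.
have := grid_sumD d (fun=> 0) (fun=> 0).
by rewrite !addF2xx.
Qed.

(** Induction on [d]: the two faces of the last coordinate contribute nothing, and prisms in that
    coordinate preserve the vanishing on the other faces because they leave the other coordinates
    alone. *)
Lemma grid_sum_coboundary_eq0 d phi : phi [::] = 0 ->
  (forall j c s, (j < d)%N -> (c == 0%N) || (c == k) ->
     all (fun x : nat -> nat => x j == c) s -> phi s = 0) ->
  grid_sum d (coboundary phi) = 0.
Proof.
elim: d phi => [|d ih] phi h0 h; first by rewrite /= h0 addr0.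
have hI c : (c == 0%N) || (c == k) ->
    grid_sum d (fun s => phi (map (set_coord d c) s)) = 0.
  move=> hc; rewrite -(grid_sum0 d); apply: eq_grid_sum => s.
  apply: (h d c) => //; rewrite all_map.
  by elim: s => //= x s ->; rewrite /set_coord eqxx eqxx.
rewrite grid_sum_coboundary !hI ?eqxx ?orbT // !add0r.
apply: big1 => z _; apply: ih => // j c s jd hc hs.
apply: (prism_eq0 (P := fun x => x j == c) (Q := fun x => x j == c)) => //.
  by move=> x xj; rewrite /set_coord (ltn_eqF jd) xj.
by move=> t; apply: h => //; apply: ltnW.
Qed.

(** The integrand is a coboundary by [coboundary_cup]. Lateral faces contribute 0, since some bit is
    constant there. On the face [x_d = 0] the factor [b d] is 0, and on [x_d = k] it is 1, which
    leaves the same sum in one dimension less. *)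
Lemma grid_sum_cup d (b : nat -> (nat -> nat) -> 'F_2) :
  (forall j x, (j < d)%N -> x j = 0%N -> b j x = 0) ->
  (forall j x, (j < d)%N -> x j = k -> b j x = 1) ->
  grid_sum d (cup [seq b j | j <- iota 0 d] (fun=> 1)) = 1.
Proof.
elim: d b => [|d ih] b hb0 hb1 //.
rewrite (eq_grid_sum _ (psi := coboundary (cup [seq b j | j <- iota 0 d] (b d)))); last first.
  by move=> s; rewrite coboundary_cup -map_rcons -[d.+1]addn1 iotaD cats1.
rewrite grid_sum_coboundary big1 ?addr0; last first.
  move=> z _; apply: grid_sum_coboundary_eq0 => // j c s jd hc hs.
  apply: (prism_eq0 (P := fun x => x j == c) (Q := fun x => x j == c)) => //.
    by move=> x xj; rewrite /set_coord (ltn_eqF jd) xj.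
  move=> t ht; apply: (@cup_const _ _ _ _ j (if c == 0%N then 0 else 1)).
    by rewrite size_map size_iota.
  apply: sub_all ht => x /eqP xj.
  rewrite (nth_map 0%N) ?size_iota // nth_iota // add0n.
  have jd1 := leqW jd.
  case: eqP hc => [c0 _|_ /eqP ck]; first by rewrite (hb0 _ _ jd1) ?xj.
  by rewrite (hb1 _ _ jd1) ?xj.
rewrite (eq_grid_sum _ (psi := fun=> 0)); last first.
  move=> s; rewrite cup_map (@eq_cup _ _ _ (fun=> 0)) ?cup0 // => x /=.
  by rewrite hb0 // /set_coord eqxx.
rewrite grid_sum0 add0r -[RHS](ih (fun j => b j \o set_coord d k)).
- apply: eq_grid_sum => s; rewrite cup_map -map_comp.
  by apply: eq_cup => x /=; rewrite hb1 // /set_coord eqxx.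
- by move=> j x jd xj; apply: hb0; rewrite ?leqW // /set_coord ltn_eqF.
- by move=> j x jd xj; apply: hb1; rewrite ?leqW // /set_coord ltn_eqF.
Qed.

Definition in_cell (d : nat) (q x : nat -> nat) : bool :=
  [forall j : 'I_d, q j <= x j <= (q j).+1]%N.

Lemma grid_sum_neq0 d phi : grid_sum d phi != 0 ->
  exists q s, [/\ forall j, (j < d)%N -> (q j < k)%N,
    all (in_cell d q) s & phi s != 0].
Proof.
elim: d phi => [|d ih] phi /=.
  move=> h; exists (fun=> 0%N), [:: fun=> 0%N]; split=> //=.
  by rewrite andbT; apply/forallP => -[].
pose P (z : 'I_k) := grid_sum d (prism (set_coord d z) (set_coord d z.+1) phi) != 0.
have [[z hz] _|h] := altP (@existsP _ P); last first.
  rewrite big1 ?eqxx // => z _; apply/eqP; apply: contraNT h => h.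
  by apply/existsP; exists z.
have [q [s [qk qs /prism_neq0 hs]]] := ih _ hz.
pose q' := set_coord d z q.
have [|t ht pt] := hs (in_cell d q) (in_cell d.+1 q') _ qs.
  move=> x /forallP xq; apply/andP; split; apply/forallP => j.
    rewrite /q' /set_coord; case: ifP => [_|]; first by rewrite leqnn leqnSn.
    move=> /negbT jd; have jd' : (j < d)%N by rewrite ltn_neqAle jd -ltnS /=.
    exact: (xq (Ordinal jd')).
  rewrite /q' /set_coord; case: ifP => [_|]; first by rewrite leqnn leqnSn.
  move=> /negbT jd; have jd' : (j < d)%N by rewrite ltn_neqAle jd -ltnS /=.
  exact: (xq (Ordinal jd')).
exists q', t; split=> // j; rewrite /q' /set_coord ltnS leq_eqVlt.
by case: eqP => //= _; apply: qk.
Qed.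

(** Every factor of a nonzero product is nonzero, and the factor of index [i] is the change of the
    [i]-th bit along one edge of the simplex. *)
Lemma cup_neq0 (T : Type) (l : seq (T -> 'F_2)) g s (P : pred T) i :
  (i < size l)%N -> all P s -> cup l g s != 0 ->
  exists x y, [/\ P x, P y, nth (fun=> 0) l i x = 0 & nth (fun=> 0) l i y = 1].
Proof.
elim: l i s => [|b l ih] [|i] [|x [|y s]] //=; rewrite ?eqxx //.
  move=> _ /and3P[Px Py _]; rewrite mulf_eq0 negb_or => /andP[bxy _].
  have [bx|/F2_eq1 bx] := eqVneq (b x) 0.
    by exists x, y; split=> //; apply: F2_eq1; rewrite bx add0r in bxy.
  exists y, x; split=> //; apply/eqP; apply: contraNT bxy => /F2_eq1 ->.
  by rewrite bx.
rewrite ltnS mulf_eq0 negb_or => il /and3P[_ Py Ps] /andP[_].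
by apply: ih => //=; rewrite Py.
Qed.

Lemma Kuhn_cell d (b : nat -> (nat -> nat) -> bool) :
  (forall j x, (j < d)%N -> x j = 0%N -> b j x = false) ->
  (forall j x, (j < d)%N -> x j = k -> b j x = true) ->
  exists2 q, (forall j, (j < d)%N -> (q j < k)%N) &
  forall j, (j < d)%N -> exists x y,
    [/\ in_cell d q x, in_cell d q y, ~~ b j x & b j y].
Proof.
move=> hb0 hb1; pose c j x : 'F_2 := (b j x)%:R.
have : grid_sum d (cup [seq c j | j <- iota 0 d] (fun=> 1)) != 0.
  rewrite grid_sum_cup ?oner_eq0 // => j x jd xj; first by rewrite /c hb0.
  by rewrite /c hb1.
case/grid_sum_neq0=> q [s [qk sq hs]]; exists q => // j jd.
have [|x [y [xq yq]]] := cup_neq0 (i := j) _ sq hs.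
  by rewrite size_map size_iota.
rewrite (nth_map 0%N) ?size_iota // nth_iota // add0n => bx yb.
exists x, y; split=> //; first by apply/negP => h; move: bx; rewrite /c h.

by move: yb; rewrite /c; case: (b j y) => // /eqP; rewrite eq_sym oner_eq0.
Qed.
End Grid.

(** * Brouwer's fixed point theorem *)

(** Limits along an ultrafilter replace the extraction of subsequences: a cluster point is a limit,
    because the preimage of a neighbourhood or its complement belongs to [U]. *)
Lemma ultra_compact_cvg (S : Type) (U : set_system S) (T : topologicalType)
    (A : set T) (u : S -> T) :
  UltraFilter U -> compact A -> (\forall n \near U, A (u n)) ->
  exists2 l, A l & u @ U --> l.
Proof.
move=> UU cA uA; have [l [Al cl]] := cA (u @ U) _ uA.
exists l => // B Bl; have [//|nB] := in_ultra_setVsetC (u @^-1` B) UU.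
by have [x [/= ? ?]] := cl (~` B) B nB Bl.
Qed.

Lemma ultra_bounded_cvg (R : realType) (S : Type) (U : set_system S) (c : R)
    (u : S -> R) :
  UltraFilter U -> (forall n, `|u n| <= c) -> exists2 l, `|l| <= c & u @ U --> l.
Proof.
move=> UU uc; have [||l lc ul] := @ultra_compact_cvg _ U R `[-c, c] u UU.
- exact: segment_compact.
- by apply: nearW => n /=; rewrite in_itv /= -ler_norml.
- by exists l => //; move: lc; rewrite /= in_itv /= -ler_norml.
Qed.

Section Brouwer.
Variables (R : realType) (U : set_system nat).
Hypotheses (UU : UltraFilter U) (Uoo : U --> \oo).

Lemma cvg_harmonic_close (a : R) (u v : nat -> R) (l : R) : u @ U --> l ->
  (forall n, `|v n - u n| <= a * n.+1%:R^-1) -> v @ U --> l.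
Proof.
move=> ul uv; have h0 : (fun n => a * n.+1%:R^-1) @ U --> (0 : R).
  rewrite -(mulr0 a); apply: cvgM; first exact: cvg_cst.
  by move=> B /(@cvg_harmonic R); exact: Uoo.
have -> : v = u + (v - u) by apply/funext => n /=; rewrite fctE addrC subrK.
rewrite -[l]addr0; apply: cvgD => //; apply: norm_cvg0.
apply: (squeeze_cvgr _ (cvg_cst 0) h0); apply: nearW => n /=.
by rewrite normr_ge0 /= uv.
Qed.

(** The truncation by [minn] places every [z] in the cube [[-c, c]^I], so vertices need no bound
    hypotheses. *)
Definition grid_point (I : finType) (c : R) (k : nat) (z : nat -> nat) (i : I) : R :=
  c * (2 * ((minn (z (enum_rank i)) k)%:R / k%:R) - 1).

Lemma grid_point_box (I : finType) (c : R) k z (i : I) : 0 <= c ->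
  `|grid_point c k.+1 z i| <= c.
Proof.
move=> c0; rewrite normrM (ger0_norm c0) ler_piMr // ler_norml.
set r := _ / _; have r0 : 0 <= r by rewrite divr_ge0.
have r1 : r <= 1 by rewrite ler_pdivrMr ?ltr0n // mul1r ler_nat geq_minr.
by apply/andP; split; lra.
Qed.

Lemma grid_point_cell (I : finType) (c : R) k (q z : nat -> nat) (i : I) : 0 <= c ->
  in_cell #|I| q z ->
  `|grid_point c k.+1 z i - grid_point c k.+1 q i| <= 2 * c * k.+1%:R^-1.
Proof.
move=> c0 /forallP/(_ (enum_rank i))/andP[h1 h2]; rewrite /grid_point.
set m := minn _ _; set m' := minn (q _) _.
have mm' : (m' <= m)%N by rewrite /m /m' leq_min geq_minr geq_min h1.
have mm1 : (m <= m'.+1)%N by rewrite /m /m' -minnSS leq_min !geq_min h2 leqnSn orbT.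
have -> : c * (2 * (m%:R / k.+1%:R) - 1) - c * (2 * (m'%:R / k.+1%:R) - 1) =
  2 * c * k.+1%:R^-1 * (m - m')%:R :> R by rewrite natrB //; ring.
rewrite normrM ger0_norm ?mulr_ge0 // ler_piMr ?mulr_ge0 //.
by rewrite ger0_norm // lern1 leq_subLR addn1.
Qed.

Lemma Brouwer (I : finType) (c : R) (g : (I -> R) -> (I -> R)) : 0 <= c ->
  (forall x, (forall i, `|x i| <= c) -> forall i, `|g x i| <= c) ->
  (forall (x : nat -> I -> R) l, (forall n i, `|x n i| <= c) ->
     (forall i, x^~ i @ U --> l i) -> forall i, (fun n => g (x n) i) @ U --> g l i) ->
  exists2 x, (forall i, `|x i| <= c) & g x = x.
Proof.
move=> c0 gc gU.
have step n : exists x : I -> R, (forall i, `|x i| <= c) /\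
   forall i, exists u v : I -> R, [/\
     forall j, `|u j| <= c /\ `|u j - x j| <= 2 * c * n.+1%:R^-1,
     forall j, `|v j| <= c /\ `|v j - x j| <= 2 * c * n.+1%:R^-1,
     u i <= g u i & g v i <= v i].
  pose pt z : I -> R := grid_point c n.+1 z.
  (* The bit tells that [g] does not increase the coordinate. The values forced on the two faces
     agree with this reading, up to equality cases, because [g] maps the cube into itself. *)
  pose b j z := (0 < z j)%N && ((z j == n.+1) ||
    [exists i : I, (enum_rank i == j :> nat) && (g (pt z) i <= pt z i)]).
  have [||q qk hq] := @Kuhn_cell n.+1 #|I| b.
  - by move=> j x _ xj; rewrite /b xj.
  - by move=> j x _ xj; rewrite /b xj eqxx.
  exists (pt q); split=> [i|i]; first exact: grid_point_box.
  have [x [y [xq yq nb bb]]] := hq (enum_rank i) (ltn_ord _).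
  exists (pt x), (pt y); split.
  - by move=> j; split; [exact: grid_point_box|exact: grid_point_cell].
  - by move=> j; split; [exact: grid_point_box|exact: grid_point_cell].
  - have gx : `|g (pt x) i| <= c by apply: gc => j; exact: grid_point_box.
    move: nb; rewrite /b negb_and -leqNgt leqn0 => /orP[/eqP x0|].
      rewrite {1}/pt /grid_point x0 min0n mul0r mulr0 sub0r mulrN1.
      by move: gx; rewrite ler_norml => /andP[].
    rewrite negb_or => /andP[_ /existsPn/(_ i)]; rewrite eqxx /= -ltNge.
    exact: ltW.
  - have gy : `|g (pt y) i| <= c by apply: gc => j; exact: grid_point_box.
    move: bb => /andP[_ /orP[/eqP x1|/existsP[i' /andP[/eqP/val_inj/enum_rank_inj ->]]]] //.
    rewrite {2}/pt /grid_point x1 minnn divff ?pnatr_eq0 //.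
    move: gy; rewrite ler_norml => /andP[_ h]; apply: le_trans h _.
    by rewrite -{1}[c]mulr1; apply: ler_wpM2l => //; lra.
have [x hx] := choice step.
have xl i : exists l, `|l| <= c /\ x^~ i @ U --> l.
  have [|l lc ul] := @ultra_bounded_cvg R nat U c (x^~ i) UU; last by exists l.
  by move=> n; have [] := hx n.
have [l hl] := choice xl.
exists l; first by move=> i; have [] := hl i.
have lc i : (x^~ i) @ U --> l i by have [] := hl i.
apply/funext => i.
(* For fixed [i], both companions of [x n] converge to [l], so their opposite inequalities give
   [l i <= g l i] and [g l i <= l i]. *)
have uv n : exists w : (I -> R) * (I -> R), [/\
     forall j, `|w.1 j| <= c /\ `|w.1 j - x n j| <= 2 * c * n.+1%:R^-1,
     forall j, `|w.2 j| <= c /\ `|w.2 j - x n j| <= 2 * c * n.+1%:R^-1,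
     w.1 i <= g w.1 i & g w.2 i <= w.2 i].
  by have [_ /(_ i)[u [v h]]] := hx n; exists (u, v).
have [w hw] := choice uv.
have w1 j : (fun n => (w n).1 j) @ U --> l j.
  by apply: (@cvg_harmonic_close (2 * c) _ _ _ (lc j)) => n; have [h _ _ _] := hw n; case: (h j).
have w2 j : (fun n => (w n).2 j) @ U --> l j.
  by apply: (@cvg_harmonic_close (2 * c) _ _ _ (lc j)) => n; have [_ h _ _] := hw n; case: (h j).
have g1 := gU (fun n => (w n).1) l _ w1 i.
have g2 := gU (fun n => (w n).2) l _ w2 i.
apply/eqP; rewrite eq_le; apply/andP; split.
- apply: (ler_cvg_to (g2 _) (w2 i)).
    by move=> n j; have [_ h _ _] := hw n; case: (h j).
  by apply: nearW => n; have [] := hw n.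
- apply: (ler_cvg_to (w1 i) (g1 _)).
    by move=> n j; have [h _ _ _] := hw n; case: (h j).
  by apply: nearW => n; have [] := hw n.
Qed.
End Brouwer.

(** * Periodic Euler polygons *)

Lemma row_norm_le (R : realType) (N : nat) (x : 'rV[R]_N) c : 0 <= c ->
  (forall i, `|x ord0 i| <= c) -> `|x| <= c.
Proof.
move=> c0 h; rewrite [leLHS]/Num.norm /= mx_normrE; apply/bigmax_leP.
by split=> // -[i j] _ /=; rewrite ord1.
Qed.

Lemma row_norm_ge (R : realType) (N : nat) (x : 'rV[R]_N) i : `|x ord0 i| <= `|x|.
Proof.
rewrite [leRHS]/Num.norm /= mx_normrE; apply/bigmax_geP; right => /=.
by exists (ord0, i).
Qed.

Lemma row_cvg (R : realType) (N : nat) (S : Type) (F : set_system S)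
    (x : S -> 'rV[R]_N) (l : 'rV[R]_N) : Filter F ->
  (forall i, (fun n => x n ord0 i) @ F --> l ord0 i) -> x @ F --> l.
Proof.
move=> FF h; apply/cvgrPdist_le => e e0.
have : \forall n \near F, forall i, `|l ord0 i - x n ord0 i| <= e.
  by apply: filter_forall => i; apply: cvgr_dist_le (h i) _ e0.
apply: filterS => n hn; apply: row_norm_le (ltW e0) _ => i.
by rewrite !mxE.
Qed.

Lemma row_coord_cvg (R : realType) (N : nat) (S : Type) (F : set_system S)
    (x : S -> 'rV[R]_N) (l : 'rV[R]_N) i : Filter F ->
  x @ F --> l -> (fun n => x n ord0 i) @ F --> l ord0 i.
Proof.
move=> FF h; apply/cvgrPdist_le => e e0.
near=> n; have -> : l ord0 i - x n ord0 i = (l - x n) ord0 i by rewrite !mxE.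
apply: le_trans (row_norm_ge _ _) _; near: n.
exact: cvgr_dist_le h _ e0.
Unshelve. all: by end_near. Qed.

(** * Truncated distance to the complement of a set *)

Section Gap.
Variables (R : realType) (V : normedModType R) (a : R).
Hypothesis a0 : 0 <= a.
Implicit Types (G : set V) (x y : V).

(* The element 1 truncates the distance and keeps the set nonempty when [G] is the
   whole space, where [inf] would return the junk value 0. *)
Definition gap G x : R := inf ([set 1] `|` [set a * `|x - z| | z in ~` G]).

Let gap_set G x := [set (1 : R)] `|` [set a * `|x - z| | z in ~` G].

Let gap_set_lb G x : lbound (gap_set G x) 0.
Proof. by move=> r [->|[z _ <-]]; rewrite ?ler01 ?mulr_ge0. Qed.

Let gap_set0 G x : gap_set G x !=set0.
Proof. by exists 1; left. Qed.

Let gap_le G x r : gap_set G x r -> gap G x <= r.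
Proof. by move=> hr; apply: ge_inf => //; exists 0; exact: gap_set_lb. Qed.

Lemma gap_ge0 G x : 0 <= gap G x.
Proof. by apply: lb_le_inf (gap_set0 G x) (@gap_set_lb G x). Qed.

Lemma gap_le1 G x : gap G x <= 1.
Proof. by apply: gap_le; left. Qed.

Lemma gap_lip G x y : gap G x <= gap G y + a * `|x - y|.
Proof.
rewrite -lerBlDr; apply: lb_le_inf; first exact: gap_set0.
move=> r hr; rewrite lerBlDr.
case: hr => [->|[z Gz <-]].
  by apply: le_trans (gap_le1 _ _) _; rewrite lerDl mulr_ge0.
apply: le_trans (@gap_le G x (a * `|x - z|) _) _; first by right; exists z.
by rewrite -mulrDr ler_wpM2l // [leRHS]addrC; exact: ler_distD.
Qed.

Lemma gap_out G x : ~ G x -> gap G x = 0.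
Proof.
move=> nG; apply/eqP; rewrite eq_le gap_ge0 andbT; apply: gap_le.
by right; exists x => //; rewrite subrr normr0 mulr0.
Qed.

Lemma gap_lt1 G x : gap G x < 1 -> exists2 z, ~ G z & a * `|x - z| < 1.
Proof.
move=> /(inf_lt (gap_set0 G x))[r [->|[z Gz <-] h]]; first by rewrite ltxx.
by exists z.
Qed.

Lemma gap_cvg G (S : Type) (F : set_system S) (x : S -> V) l : Filter F ->
  x @ F --> l -> gap G (x n) @[n --> F] --> gap G l.
Proof.
move=> FF xl; apply/cvgrPdist_le => e e0.
have a1 : 0 < a + 1 by rewrite ltr_wpDl.
near=> n; apply: (@le_trans _ _ (a * `|l - x n|)).
  have := gap_lip G l (x n); have := gap_lip G (x n) l.
  by rewrite (distrC (x n)) => h1 h2; rewrite ler_norml; apply/andP; split; lra.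
apply: (@le_trans _ _ ((a + 1) * `|l - x n|)).
  by rewrite ler_wpM2r // lerDl.
rewrite mulrC -ler_pdivlMr //.
by near: n; apply: cvgr_dist_le xl _ (divr_gt0 e0 a1).
Unshelve. all: by end_near. Qed.

End Gap.

(** * The discretized periodic problem *)

Section Discrete.
Variables (R : realType) (U : set_system nat).
Hypotheses (UU : UltraFilter U) (Uoo : U --> \oo).

Lemma prod_cvg (I : finType) (u : nat -> I -> R) (l : I -> R) :
  (forall i, u^~ i @ U --> l i) -> \prod_i u n i @[n --> U] --> \prod_i l i.
Proof.
move=> h; elim: (index_enum I) => [|i s ih].
  by under eq_fun do rewrite big_nil; rewrite big_nil; exact: cvg_cst.
under eq_fun do rewrite big_cons; rewrite big_cons.
exact: cvgM (h i) ih.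
Qed.

Lemma prod_lt1 (I : finType) (u : I -> R) : (forall i, u i <= 1) ->
  \prod_i u i < 1 -> exists i, u i < 1.
Proof.
move=> u1 h; apply: contrapT => /forallNP hn.
move: h; rewrite big1 ?ltxx // => i _; apply/eqP; rewrite eq_le u1 /= leNgt.
exact/negP/hn.
Qed.

Variables (N : nat) (G : set 'rV[R]_N) (p : 'rV[R]_N) (T : R).
Variables (f : R -> 'rV[R]_N -> 'rV[R]_N) (c : R) (k : nat) (h a : R).
Hypotheses (Gp : G p) (h0 : 0 < h) (h1 : h <= 1) (hT : h * k.+1%:R = T).
Hypotheses (a0 : 0 <= a) (c0 : 0 <= c).
Hypothesis fc : forall t x, 0 <= t <= T -> G x -> `|f t x + (x - p)| <= c.
Hypothesis f_cvg : forall (x : nat -> 'rV[R]_N) l t, 0 <= t <= T -> G l ->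
  x @ U --> l -> f t (x n) @[n --> U] --> f t l.

Let I := ('I_k.+1 * 'I_N)%type.
Let point (x : I -> R) (j : 'I_k.+1) : 'rV[R]_N := p + \row_i x (j, i).
Let weight (x : I -> R) : R := \prod_j gap a G (point x j).
Let time (j : 'I_k.+1) : R := h * j%:R.
(** An Euler step for [y' = w f - (1 - w)(y - p)] in the coordinates [y - p]. Adding [y - p] to [f]
    turns it into a convex combination with weights [1 - h] and [h], which preserves the cube of
    radius [c]. *)
Let step (x : I -> R) (ji : I) : R :=
  let j := ord_pred ji.1 in
  (1 - h) * x (j, ji.2) +
  h * (weight x * (f (time j) (point x j) + (point x j - p)) ord0 ji.2).

Let time_in j : 0 <= time j <= T.
Proof.
rewrite /time mulr_ge0 ?(ltW h0) //= -hT ler_wpM2l ?(ltW h0) //.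
by rewrite ler_nat ltnW.
Qed.

Let weight_ge0 x : 0 <= weight x.
Proof. by apply: prodr_ge0 => j _; exact: gap_ge0. Qed.

Let weight_le1 x : weight x <= 1.
Proof. by apply: prodr_ile1 => j _; rewrite gap_ge0 // gap_le1. Qed.

Let weight_neq0 x j : weight x != 0 -> G (point x j).
Proof.
move=> /prodf_neq0/(_ j isT)/eqP hg; apply: contrapT => nG; apply: hg.
exact: gap_out.
Qed.

Let term_le x (ji : I) :
  `|weight x * (f (time ji.1) (point x ji.1) + (point x ji.1 - p)) ord0 ji.2| <= c.
Proof.
have [->|/weight_neq0 Gx] := eqVneq (weight x) 0; first by rewrite mul0r normr0.
rewrite normrM -[leRHS]mul1r ler_pM // ?(ger0_norm (weight_ge0 x)) //.
exact: le_trans (row_norm_ge _ _) (fc (time_in _) (Gx _)).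
Qed.

Let step_le x : (forall ji, `|x ji| <= c) -> forall ji, `|step x ji| <= c.
Proof.
move=> xc ji; apply: le_trans (ler_normD _ _) _.
have -> : c = (1 - h) * c + h * c by ring.
have h2 : 0 <= 1 - h by rewrite subr_ge0.
rewrite normrM (ger0_norm h2) (normrM h) (gtr0_norm h0).
apply: lerD; first by rewrite ler_wpM2l.
rewrite ler_wpM2l ?(ltW h0) //.
exact: (term_le x (ord_pred ji.1, ji.2)).
Qed.

Let point_cvg (x : nat -> I -> R) l j : (forall ji, x^~ ji @ U --> l ji) ->
  point (x n) j @[n --> U] --> point l j.
Proof.
move=> xl; apply: row_cvg => i; rewrite !mxE.
under eq_fun do rewrite !mxE.
apply: cvgD; [exact: cvg_cst|exact: xl].
Qed.

Let step_cvg (x : nat -> I -> R) l :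
  (forall ji, x^~ ji @ U --> l ji) -> forall ji, step (x n) ji @[n --> U] --> step l ji.
Proof.
move=> xl [j i] /=; rewrite /step /=; set j' := ord_pred j.
have wl : weight (x n) @[n --> U] --> weight l.
  by apply: prod_cvg => r; apply: gap_cvg => //; exact: point_cvg.
apply: cvgD; first by apply: cvgM; [exact: cvg_cst|exact: xl].
apply: cvgM; first exact: cvg_cst.
have [w0|wn0] := eqVneq (weight l) 0; last first.
  apply: cvgM => //; apply: row_coord_cvg; apply: cvgD.
    by apply: f_cvg; [exact: time_in|exact: weight_neq0|exact: point_cvg].
  by apply: cvgB; [exact: point_cvg|exact: cvg_cst].
(* Where the limit weight is 0, limit vertices may leave [G] and [f] need not be continuous there;
   the bound [weight * c] suffices. *)
rewrite w0 mul0r; apply: norm_cvg0.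
have wc : weight (x n) * c @[n --> U] --> (0 : R).
  by rewrite -(mul0r c) -w0; apply: cvgM => //; exact: cvg_cst.
apply: (squeeze_cvgr _ (cvg_cst 0) wc); apply: nearW => n.
rewrite normr_ge0 /=.
have [->|/weight_neq0 Gx] := eqVneq (weight (x n)) 0; first by rewrite !mul0r normr0.
rewrite normrM ger0_norm // ler_wpM2l //.
exact: le_trans (row_norm_ge _ _) (fc (time_in _) (Gx _)).
Qed.

Lemma discrete_periodic : exists (X : nat -> 'rV[R]_N) (w : R),
  [/\ 0 <= w <= 1, X k.+1 = X 0%N, forall j, G (X j),
   forall j, (j <= k)%N ->
     X j.+1 - X j = h *: (w *: f (h * j%:R) (X j) - (1 - w) *: (X j - p)) &
   w < 1 -> exists j z, [/\ (j <= k)%N, ~ G z & a * `|X j - z| < 1]].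
Proof.
have [x xc xfix] := @Brouwer R U UU Uoo I c step c0 step_le (fun x l _ => @step_cvg x l).
have xE j i : x (j, i) = step x (j, i) by rewrite xfix.
pose X j := point x (inord (j %% k.+1)).
have Gx j : G (point x j).
  have [w0|] := eqVneq (weight x) 0; last exact: weight_neq0.
  (* With weight 0, each entry is [1 - h] times its predecessor, so an entry of maximal modulus
     vanishes and the polygon is the constant [p]. *)
  suff x0 ji : x ji = 0.
    suff -> : point x j = p by [].
    by apply/rowP => i; rewrite !mxE x0 addr0.
  have [/= m _ hm] := @arg_maxP _ _ _ ji predT (fun ji => `|x ji|) isT.
  have : `|x m| <= (1 - h) * `|x m|.
    rewrite {1}[m]surjective_pairing xE /step w0 mul0r mulr0 addr0 normrM.
    by rewrite ger0_norm ?subr_ge0 // ler_wpM2l ?subr_ge0 //; exact: hm.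
  have := normr_ge0 (x m); have := hm ji isT => /= /le_trans hji m0 hA.
  apply/eqP; rewrite -normr_le0; apply: hji.
  by rewrite -(pmulr_rle0 _ h0); lra.
exists X, (weight x); split => //.
- by rewrite weight_ge0 weight_le1.
- by rewrite /X modnn mod0n.
- by move=> j; exact: Gx.
- move=> j jk; have jk1 : (j < k.+1)%N by [].
  pose J : 'I_k.+1 := Ordinal jk1.
  have -> : X j = point x J.
    by congr point; apply: val_inj; rewrite /= modn_small // inordK.
  have -> : X j.+1 = point x (ordS J).
    by congr point; apply: val_inj; rewrite /= inordK // ltn_mod.
  apply/rowP => i; rewrite !mxE (xE (ordS J)) /step /= ordSK !mxE.
  by rewrite /time /=; ring.
- move=> /prod_lt1[j|j /gap_lt1[z Gz hz]]; first exact: gap_le1.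
  exists j, z; split=> //; first by rewrite -ltnS.
  by rewrite /X modn_small // inord_val.
Qed.
End Discrete.

(** * Bony normals *)

Section Inner.
Variables (R : realType) (N : nat).
Implicit Types (u v w nu : 'rV[R]_N) (M G : set 'rV[R]_N).

Lemma innerC u v : inner u v = inner v u.
Proof. by apply: eq_bigr => i _; rewrite mulrC. Qed.

Lemma innerDl u v w : inner (u + v) w = inner u w + inner v w.
Proof. by rewrite -big_split; apply: eq_bigr => i _; rewrite mxE mulrDl. Qed.

Lemma innerZl a u v : inner (a *: u) v = a * inner u v.
Proof. by rewrite /inner mulr_sumr; apply: eq_bigr => i _; rewrite mxE mulrA. Qed.

Lemma innerNl u v : inner (- u) v = - inner u v.
Proof. by rewrite -scaleN1r innerZl mulN1r. Qed.

Lemma innerDr u v w : inner u (v + w) = inner u v + inner u w.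
Proof. by rewrite !(innerC u) innerDl. Qed.

Lemma innerZr a u v : inner u (a *: v) = a * inner u v.
Proof. by rewrite !(innerC u) innerZl. Qed.

Lemma innerNr u v : inner u (- v) = - inner u v.
Proof. by rewrite !(innerC u) innerNl. Qed.

Definition innerE := (innerDl, innerDr, innerNl, innerNr, innerZl, innerZr).

Lemma inner_ge0 u : 0 <= inner u u.
Proof. by apply: sumr_ge0 => i _; rewrite -expr2 sqr_ge0. Qed.

Lemma inner_gt0 u : u != 0 -> 0 < inner u u.
Proof.
move=> u0; rewrite lt_def inner_ge0 andbT; apply: contraNneq u0 => /eqP.
rewrite psumr_eq0 => [/allP h|i _]; last by rewrite -expr2 sqr_ge0.
apply/eqP/rowP => i; rewrite mxE; apply/eqP.
by have := h i (mem_index_enum i); rewrite mulf_eq0 orbb.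
Qed.

Lemma inner_le_norm u v : `|inner u v| <= `|u| * \sum_i `|v ord0 i|.
Proof.
apply: le_trans (ler_norm_sum _ _ _) _; rewrite mulr_sumr.
by apply: ler_sum => i _; rewrite normrM ler_wpM2r // row_norm_ge.
Qed.

Lemma inner_self_le u : inner u u <= N%:R * `|u| ^+ 2.
Proof.
apply: le_trans (ler_norm _) _; apply: le_trans (inner_le_norm _ _) _.
rewrite expr2 mulrCA ler_wpM2l //.
apply: (@le_trans _ _ (\sum_(i < N) `|u|)).
  by apply: ler_sum => i _; exact: row_norm_ge.
by rewrite sumr_const card_ord mulr_natl.
Qed.

(** Squaring the two distances to [u + l *: nu] and expanding removes the square roots. *)
Lemma bony_normalP M u nu : bony_normals M u nu ->
  exists2 l, 0 < l & forall v, M v -> 2 * l * inner (v - u) nu <= inner (v - u) (v - u).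
Proof.
move=> [_ [l l0 [_ h]]]; exists l => // v /h.
rewrite /enorm ler_sqrt ?inner_ge0 //.
have -> : u - (u + l *: nu) = - (l *: nu) by rewrite opprD addrA subrr sub0r.
have -> : v - (u + l *: nu) = (v - u) - l *: nu by rewrite opprD addrA.
move: (v - u) => w; rewrite !innerE (innerC nu w); lra.
Qed.

Lemma le0_of_small (A B : R) :
  (forall s, 0 < s <= 1 -> s * A <= s ^+ 2 * B) -> A <= 0.
Proof.
move=> h; rewrite leNgt; apply/negP => A0.
have B0 : 0 < B by have := h 1; rewrite ltr01 lexx !mul1r expr1n mul1r => /(_ isT); lra.
pose s := Num.min 1 (A / (2 * B)).
have s0 : 0 < s by rewrite lt_min ltr01 divr_gt0 ?mulr_gt0.
have := h s; rewrite s0 ge_min lexx => /(_ isT).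
rewrite expr2 -mulrA ler_pM2l //; apply/negP; rewrite -ltNge.
have : s <= A / (2 * B) by rewrite ge_min lexx orbT.
rewrite ler_pdivlMr ?mulr_gt0 //; lra.
Qed.

(** The points [u + s (q - u)] lie in [G] for small [s > 0]; in the Bony inequality the left side is
    linear in [s] and the right side quadratic. *)
Lemma bony_normal_star G u nu q : bony_normals (closure G) u nu ->
  boundary G u -> closure_strictly_star_shaped G q -> inner (q - u) nu <= 0.
Proof.
move=> /bony_normalP[l l0 h] bu [_ /(_ u bu) hq].
suff : 2 * l * inner (q - u) nu <= 0 by rewrite pmulr_rle0 // mulr_gt0.
apply: (@le0_of_small _ (inner (q - u) (q - u))) => s /andP[s0 s1].
have /h : closure G (q + (1 - s) *: (u - q)).
  apply: subset_closure; apply: hq; exists (1 - s) => //=.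
  by rewrite in_itv /= subr_ge0 s1 /= ltrBlDr ltrDl.
have -> : q + (1 - s) *: (u - q) - u = s *: (q - u).
  by apply/rowP => i; rewrite !mxE; ring.
rewrite !innerE; lra.
Qed.

Lemma bony_normal_ball G u nu p delta : 0 < delta ->
  (forall q, eclosed_ball p delta q -> closure_strictly_star_shaped G q) ->
  bony_normals (closure G) u nu -> boundary G u -> 0 < inner (u - p) nu.
Proof.
move=> d0 hs hnu bu; have nu0 := inner_gt0 hnu.1.
have e0 : 0 < enorm nu by rewrite sqrtr_gt0.
(* The point [p + r nu] is the point of the ball farthest in the direction [nu]; it yields
   [r |nu|^2 <= <u - p, nu>]. *)
pose r := delta / enorm nu; have r0 : 0 < r by rewrite divr_gt0.
have /(bony_normal_star hnu bu) : closure_strictly_star_shaped G (p + r *: nu).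
  apply: hs; rewrite /eclosed_ball /=.
  have -> : p + r *: nu - p = r *: nu by rewrite addrAC subrr add0r.
  rewrite /enorm !innerE mulrA -expr2 sqrtrM ?sqr_ge0 // sqrtr_sqr gtr0_norm //.
  by rewrite -/(enorm nu) /r divfK // gt_eqF.
have -> : p + r *: nu - u = r *: nu - (u - p).
  by apply/rowP => i; rewrite !mxE; ring.
rewrite !innerDl innerNl innerZl => h.
have : 0 < r * inner nu nu by rewrite mulr_gt0.
move: h; rewrite !innerE; lra.
Qed.

(** Free of division, so that estimates on Euler polygons pass to the limit directly and [s = t] is
    no exception. *)
Definition derivative_in (T : R) (y : R -> 'rV[R]_N) (t : R) v :=
  forall e, 0 < e -> exists2 r, 0 < r & forall s, 0 <= s <= T -> `|s - t| < r ->
    `|y s - y t - (s - t) *: v| <= e * `|s - t|.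

Lemma derivative_in_cvg T y t v : derivative_in T y t v ->
  (s - t)^-1 *: (y s - y t) @[s --> within `[0, T]%classic t^'] --> v.
Proof.
move=> h; apply/cvgrPdist_le => e e0; have [r r0 hr] := h e e0.
rewrite near_withinE; near=> s => /=; rewrite in_itv /= => s0T.
have st : s - t != 0 by rewrite subr_eq0; near: s; exact: nbhs_dnbhs_neq.
have sr : `|s - t| < r.
  by rewrite distrC; near: s; apply: nbhs_dnbhs; exact: nbhsx_ballx.
have -> : v - (s - t)^-1 *: (y s - y t) =
    - ((s - t)^-1 *: (y s - y t - (s - t) *: v)).
  by rewrite [in RHS]scalerBr scalerA mulVf // scale1r opprB.
rewrite normrN normrZ normfV mulrC ler_pdivrMr ?normr_gt0 //.
exact: hr.
Unshelve. all: by end_near. Qed.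

(* Only times before [t] are used, where the difference quotient points inward. *)
Lemma viable_derivative_bony T y t v M nu : 0 < t <= T ->
  (forall s, 0 <= s <= T -> M (y s)) -> derivative_in T y t v ->
  bony_normals M (y t) nu -> 0 <= inner v nu.
Proof.
move=> /andP[t0 tT] yM hd /bony_normalP[l l0 h].
rewrite leNgt; apply/negP => D0.
pose S := \sum_i `|nu ord0 i|; have S0 : 0 <= S by exact: sumr_ge0.
pose D := - inner v nu; have {}D0 : 0 < D by rewrite oppr_gt0.
(* The error of the linear approximation then uses up at most half of [D], leaving
   [<w, nu> >= s D / 2] for the backward increment [w]. *)
pose e := Num.min 1 (D / (2 * (S + 1))).
have e0 : 0 < e by rewrite lt_min ltr01 divr_gt0 // mulr_gt0 // ltr_wpDl.
have e1 : e <= 1 by rewrite ge_min lexx.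
have eS : e * S <= D / 2.
  have : e <= D / (2 * (S + 1)) by rewrite ge_min lexx orbT.
  by rewrite ler_pdivlMr ?mulr_gt0 ?ltr_wpDl //; nra.
have [r r0 hr] := hd e e0.
pose Q := N%:R * (`|v| + 1) ^+ 2; have Q0 : 0 <= Q by rewrite mulr_ge0 ?sqr_ge0.
(* Since [|w|^2 <= s^2 Q], the Bony inequality would give [s D l <= s^2 Q], which fails once
   [s Q < D l]. *)
pose s := Num.min (Num.min (r / 2) t) (D * l / (Q + 1) / 2).
have s0 : 0 < s.
  by rewrite !lt_min t0 !divr_gt0 ?mulr_gt0 // ltr_wpDl.
have sr : s < r.
  apply: (@le_lt_trans _ _ (r / 2)); first by rewrite !ge_min lexx.
  lra.
have st : s <= t by rewrite !ge_min lexx orbT.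
have sQ : s * Q < D * l.
  have : s <= D * l / (Q + 1) / 2 by rewrite !ge_min lexx orbT.
  rewrite ler_pdivlMr // ler_pdivlMr ?ltr_wpDl //.
  have := mulr_gt0 D0 l0; nra.
have tsT : 0 <= t - s <= T by rewrite subr_ge0 st /=; lra.
have := hr (t - s) tsT; have -> : t - s - t = - s by ring.
rewrite normrN (gtr0_norm s0) => /(_ sr).
have := h _ (yM _ tsT).
set w := y (t - s) - y t; set z := w - _ => hw hz.
have wE : w = z - s *: v by rewrite /z scaleNr opprK addrK.
have wn : `|w| <= s * (`|v| + 1).
  rewrite wE; apply: le_trans (ler_normB _ _) _.
  by rewrite normrZ (gtr0_norm s0); nra.
have ww : inner w w <= s ^+ 2 * Q.
  apply: le_trans (inner_self_le _) _.
  rewrite /Q [leRHS]mulrCA -exprMn ler_wpM2l //.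
  by rewrite lerXn2r ?nnegrE // mulr_ge0 ?addr_ge0 // ltW.
have zn : `|inner z nu| <= e * s * S.
  by apply: le_trans (inner_le_norm _ _) _; rewrite ler_wpM2r.
have wnu : inner w nu = inner z nu + s * D.
  by rewrite wE !innerE /D; ring.
have : s * D / 2 <= inner w nu.
  by rewrite wnu; move: zn; rewrite ler_norml => /andP[zn _]; nra.
move=> hlow.
have : s * (D * l) <= s ^+ 2 * Q.
  apply: le_trans ww; apply: le_trans hw; nra.
by rewrite expr2 -mulrA ler_pM2l // leNgt sQ.
Qed.
End Inner.

(** * Limits of Euler polygons *)

Section Euler.
Variables (R : realType) (U : set_system nat) (N : nat) (T C : R).
Hypotheses (UU : UltraFilter U) (C0 : 0 <= C).
Variables (h : nat -> R) (K : nat -> nat) (X F : nat -> nat -> 'rV[R]_N).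
Variable A : set 'rV[R]_N.
Hypotheses (h0 : forall n, 0 < h n) (hU : h @ U --> (0 : R)).
Hypotheses (hK : forall n, h n * (K n)%:R = T).
Hypothesis (XF : forall n j, (j < K n)%N -> X n j.+1 - X n j = h n *: F n j).
Hypothesis (FC : forall n j, (j < K n)%N -> `|F n j| <= C).
Hypotheses (cA : compact A) (XA : forall n j, A (X n j)).

(** Used twice: [v = 0] gives the Lipschitz bound, and [v] the expected derivative gives
    differentiability of the limit. *)
Lemma euler_increment n a b v e : (a <= b <= K n)%N ->
  (forall j, (a <= j < b)%N -> `|F n j - v| <= e) ->
  `|X n b - X n a - (h n * b%:R - h n * a%:R) *: v| <= e * (h n * b%:R - h n * a%:R).
Proof.
move=> /andP[]; elim: b => [|b ih].
  by rewrite leqn0 => /eqP-> _ _; rewrite !subrr scale0r subrr normr0 mulr0.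
rewrite leq_eqVlt => /orP[/eqP-> _ _|].
  by rewrite !subrr scale0r subrr normr0 mulr0.
rewrite ltnS => ab bK Fv.
have {}ih : `|X n b - X n a - (h n * b%:R - h n * a%:R) *: v| <=
    e * (h n * b%:R - h n * a%:R).
  apply: ih => //; first exact: ltnW.
  by move=> j /andP[aj jb]; apply: Fv; rewrite aj ltnW.
have -> : X n b.+1 - X n a - (h n * b.+1%:R - h n * a%:R) *: v =
    (X n b - X n a - (h n * b%:R - h n * a%:R) *: v) + h n *: (F n b - v).
  have -> : X n b.+1 = X n b + h n *: F n b by rewrite -XF // addrC subrK.
  by apply/rowP => i; rewrite !mxE -natr1; ring.
have -> : e * (h n * b.+1%:R - h n * a%:R) =
  e * (h n * b%:R - h n * a%:R) + h n * e by rewrite -natr1; ring.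
apply: le_trans (ler_normD _ _) (lerD ih _).
by rewrite normrZ gtr0_norm // ler_pM2l // Fv // ab ltnSn.
Qed.

Definition node_index n (t : R) := Num.truncn (t / h n).

Lemma node_index_bounds n t : 0 <= t ->
  h n * (node_index n t)%:R <= t < h n * (node_index n t)%:R + h n.
Proof.
move=> t0; have := @truncn_itv R (t / h n) (divr_ge0 t0 (ltW (h0 n))).
by rewrite -/(node_index n t) ler_pdivlMr // ltr_pdivrMr // -natr1 mulrDl mul1r mulrC.
Qed.

Lemma node_index_le n t : 0 <= t <= T -> (node_index n t <= K n)%N.
Proof.
move=> /andP[t0 tT]; have /andP[h1 _] := node_index_bounds n t0.
by rewrite -(ler_nat R) -(ler_pM2l (h0 n)) hK (le_trans h1).
Qed.

Lemma node_index_mono n s t : s <= t -> (node_index n s <= node_index n t)%N.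
Proof. by move=> st; apply: le_truncn; rewrite ler_pM2r ?invr_gt0. Qed.

Lemma euler_lipschitz n a b : (a <= K n)%N -> (b <= K n)%N ->
  `|X n b - X n a| <= C * `|h n * b%:R - h n * a%:R|.
Proof.
wlog ab : a b / (a <= b)%N => [W aK bK|aK bK].
  have /orP[ab|ba] := leq_total a b; first exact: W.
  by rewrite distrC [X in C * X]distrC; exact: W.
have := @euler_increment n a b 0 C; rewrite ab bK scaler0 subr0.
rewrite [`|_ - h n * _|]ger0_norm; last by rewrite subr_ge0 ler_pM2l // ler_nat.
apply=> // j /andP[_ jb]; rewrite subr0; apply: FC; exact: leq_trans jb bK.
Qed.

(* The limit along the ultrafilter exists pointwise by compactness; the Lipschitz
   bound makes it insensitive to the choice of the node near [t]. *)
Lemma euler_limit : exists2 y : R -> 'rV[R]_N, forall t, A (y t) &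
  forall t (j : nat -> nat), 0 <= t <= T -> (forall n, (j n <= K n)%N) ->
    h n * (j n)%:R @[n --> U] --> t -> X n (j n) @[n --> U] --> y t.
Proof.
have yl t : exists l, A l /\ X n (node_index n t) @[n --> U] --> l.
  by have [|l Al] := @ultra_compact_cvg _ U _ A (fun n => X n (node_index n t)) UU cA;
    [exact: nearW|exists l].
have [y hy] := choice yl; exists y => [t|t j tT jK jt]; first by have [] := hy t.
have -> : (fun n => X n (j n)) =
    (fun n => X n (node_index n t) + (X n (j n) - X n (node_index n t))).
  by apply/funext => n; rewrite addrC subrK.
rewrite -[y t]addr0; apply: cvgD; first by have [] := hy t.
apply: norm_cvg0.
have z0 : C * (`|h n * (j n)%:R - t| + h n) @[n --> U] --> (0 : R).
  rewrite -(mulr0 C) -[X in C * X](addr0 0); apply: cvgM; first exact: cvg_cst.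
  apply: cvgD => //; rewrite -(normr0 R) -(subrr t).
  by apply: cvg_norm; apply: cvgB => //; exact: cvg_cst.
apply: (squeeze_cvgr _ (cvg_cst 0) z0); apply: nearW => n; rewrite normr_ge0 /=.
apply: le_trans (euler_lipschitz (node_index_le n tT) (jK n)) _.
apply: ler_wpM2l => //; have /andP[t0 _] := tT.
have /andP[] := node_index_bounds n t0; set z := h n * _ => h1 h2.
apply: le_trans (ler_distD t _ _) _; apply: lerD => //.
by rewrite ger0_norm; lra.
Qed.

Lemma node_index_cvg t : 0 <= t -> h n * (node_index n t)%:R @[n --> U] --> t.
Proof.
move=> t0; apply/cvgrPdist_le => e e0; near=> n.
have /andP[h1 h2] := node_index_bounds n t0.
have : `|h n| <= e by near: n; exact: cvgr0_norm_le.
by rewrite (gtr0_norm (h0 n)) => he; rewrite ger0_norm; lra.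
Unshelve. all: by end_near. Qed.

Lemma euler_limit_derivative y t v : 0 <= t <= T ->
  (forall s, 0 <= s <= T -> X n (node_index n s) @[n --> U] --> y s) ->
  (forall e, 0 < e -> exists2 r, 0 < r & \forall n \near U,
     forall j, (j < K n)%N -> `|h n * j%:R - t| < r -> `|F n j - v| <= e) ->
  derivative_in T y t v.
Proof.
move=> tT yl hF e e0; have [r r0 hr] := hF e e0.
(* Half of [r] is kept for the nodes, which may precede [s] or [t] by up to [h n < r / 2]. *)
exists (r / 2); first exact: divr_gt0.
move=> s sT st.
have lim1 : `|X n (node_index n s) - X n (node_index n t) - (s - t) *: v| @[n --> U]
    --> `|y s - y t - (s - t) *: v|.
  apply: cvg_norm; apply: cvgB; last exact: cvg_cst.
  by apply: cvgB; exact: yl.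
have lim2 : e * (`|s - t| + h n) + h n * `|v| @[n --> U] --> e * `|s - t|.
  rewrite -[X in _ --> X]addr0; apply: cvgD.
    apply: cvgM; first exact: cvg_cst.
    by rewrite -[X in _ --> X]addr0; apply: cvgD => //; exact: cvg_cst.
  rewrite -(mul0r `|v|); apply: cvgM => //; exact: cvg_cst.
apply: (ler_cvg_to lim1 lim2); near=> n.
have hn : h n < r / 2.
  by rewrite -[h n]gtr0_norm //; near: n; apply: cvgr0_norm_lt => //; exact: divr_gt0.
have Fn : forall j, (j < K n)%N -> `|h n * j%:R - t| < r -> `|F n j - v| <= e.
  by near: n.
have /andP[s0 _] := sT; have /andP[t0 _] := tT.
have /andP[s1 s2] := node_index_bounds n s0; have /andP[t1 t2] := node_index_bounds n t0.
have main : `|X n (node_index n s) - X n (node_index n t) -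
    (h n * (node_index n s)%:R - h n * (node_index n t)%:R) *: v| <=
    e * `|h n * (node_index n s)%:R - h n * (node_index n t)%:R|.
  have [le_st|lt_ts] := leP s t.
    have ist := node_index_mono n le_st.
    rewrite -normrN [`|h n * _ - _|]distrC [X in e * X]ger0_norm; last first.
      by rewrite subr_ge0 ler_pM2l // ler_nat.
    have -> : - (X n (node_index n s) - X n (node_index n t) -
        (h n * (node_index n s)%:R - h n * (node_index n t)%:R) *: v) =
      X n (node_index n t) - X n (node_index n s) -
        (h n * (node_index n t)%:R - h n * (node_index n s)%:R) *: v.
      by apply/rowP => i; rewrite !mxE; ring.
    apply: euler_increment; first by rewrite ist node_index_le.
    move=> j /andP[sj jt]; apply: Fn; first by rewrite (leq_trans jt) ?node_index_le.
    have : h n * (node_index n s)%:R <= h n * j%:R by rewrite ler_pM2l // ler_nat.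
    have : h n * j%:R <= h n * (node_index n t)%:R by rewrite ler_pM2l // ler_nat ltnW.
    by move: st; rewrite !ltr_norml => /andP[]; lra.
  have ist := node_index_mono n (ltW lt_ts).
  rewrite [X in e * X]ger0_norm; last first.
    by rewrite subr_ge0 ler_pM2l // ler_nat.
  apply: euler_increment; first by rewrite ist node_index_le.
  move=> j /andP[sj jt]; apply: Fn; first by rewrite (leq_trans jt) ?node_index_le.
  have : h n * (node_index n t)%:R <= h n * j%:R by rewrite ler_pM2l // ler_nat.
  have : h n * j%:R <= h n * (node_index n s)%:R by rewrite ler_pM2l // ler_nat ltnW.
  by move: st; rewrite !ltr_norml => /andP[]; lra.
move: main; set a := h n * (node_index n s)%:R; set b := h n * (node_index n t)%:R => main.
have ab : `|(a - b) - (s - t)| <= h n.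
  by rewrite ler_norml; apply/andP; split; rewrite /a /b; lra.
set z := X n _ - X n _; have -> : z - (s - t) *: v =
    (z - (a - b) *: v) + ((a - b) - (s - t)) *: v.
  by apply/rowP => i; rewrite !mxE; ring.
apply: le_trans (ler_normD _ _) _; apply: lerD.
  apply: le_trans main _; rewrite ler_pM2l //.
  by rewrite -[a - b](subrK (s - t)) addrC; apply: le_trans (ler_normD _ _) _; rewrite lerD2l.
by rewrite normrZ ler_wpM2r.
Unshelve. all: by end_near. Qed.
End Euler.

(** * Bounds and continuity of the vector field *)

Lemma bounded_set_norm_le (R : realType) (V : normedModType R) (A : set V) :
  bounded_set A -> exists2 M, 0 < M & forall x, A x -> `|x| <= M.
Proof. by move=> /pinfty_ex_gt0[M M0 h]; exists M. Qed.

Lemma bounded_set_closure (R : realType) (V : normedModType R) (A : set V) :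
  bounded_set A -> bounded_set (closure A).
Proof.
move=> /bounded_set_norm_le[M M0 h].
exists (M + 1); split; first exact: num_real.
move=> r Mr x /(_ _ (nbhsx_ballx x 1 ltr01))[z [/h zM]].
rewrite -ball_normE /ball_ /= => xz; rewrite -(subrK z x).
by apply: le_trans (ler_normD _ _) _; lra.
Qed.

Section Field.
Variables (R : realType) (N : nat) (T : R) (Omega : set 'rV[R]_N).
Variable f : R -> 'rV[R]_N -> 'rV[R]_N.
Hypothesis hf : {within `[0, T]%classic `*` Omega,
  continuous (fun z : R * 'rV[R]_N => f z.1 z.2)}.

Lemma field_dist t x e : 0 <= t <= T -> Omega x -> 0 < e ->
  exists2 r, 0 < r & forall s z, 0 <= s <= T -> Omega z ->
    `|s - t| < r -> `|z - x| < r -> `|f s z - f t x| <= e.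
Proof.
move=> tT Ox e0.
have tx : (`[0, T]%classic `*` Omega) (t, x) by split => //=; rewrite in_itv.
have /subspace_continuousP/(_ (t, x) tx)/cvgrPdist_le/(_ e e0) := hf.
rewrite near_withinE => /nbhs_ballP[r /= r0 hr].
exists r => // s z sT Oz st zx.
have := hr (s, z); rewrite /= distrC; apply.
  by split; rewrite -ball_normE /ball_ /= distrC.
by split => //=; rewrite in_itv.
Qed.

Lemma field_cvg (U : set_system nat) (x : nat -> 'rV[R]_N) l t : Filter U ->
  open Omega -> 0 <= t <= T -> Omega l -> x @ U --> l ->
  f t (x n) @[n --> U] --> f t l.
Proof.
move=> UF oO tT Ol xl; apply/cvgrPdist_le => e e0.
have [r r0 hr] := field_dist tT Ol e0.
near=> n; rewrite distrC; apply: hr => //.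
- near: n; apply: xl; exact: open_nbhs_nbhs.
- by rewrite subrr normr0.
- by rewrite distrC; near: n; exact: cvgr_dist_lt.
Unshelve. all: by end_near. Qed.

Lemma field_bounded A : compact A -> A `<=` Omega ->
  exists2 c, 0 < c & forall t x, 0 <= t <= T -> A x -> `|f t x| <= c.
Proof.
move=> cA AO.
have cT : compact (`[0, T]%classic `*` A).
  by apply: compact_setX => //; exact: segment_compact.
have : {within `[0, T]%classic `*` A, continuous (fun z : R * 'rV[R]_N => f z.1 z.2)}.
  by apply: continuous_subspaceW hf => -[t x] [/= ? /AO].
move=> /(continuous_compact) /(_ cT) /compact_bounded /bounded_set_norm_le[c c0 hc].
by exists c => // t x tT Ax; apply: hc; exists (t, x).
Qed.
End Field.

(** * Passage to the limit in the discretized problems *)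

Section Homotopy.
Variables (R : realType) (N : nat) (T : R) (Omega G : set 'rV[R]_N).
Variables (p : 'rV[R]_N) (f : R -> 'rV[R]_N -> 'rV[R]_N).
Hypotheses (T0 : 0 < T) (oOmega : open Omega) (oG : open G) (bG : bounded_set G).
Hypotheses (GOmega : closure G `<=` Omega) (Gp : G p).
Hypothesis hf : {within `[0, T]%classic `*` Omega,
  continuous (fun z : R * 'rV[R]_N => f z.1 z.2)}.

(* The last clause holds because the parameter of a discrete problem drops below 1
   only when some node is close to the complement of [G]. *)
Lemma homotopy_solution : exists (y : R -> 'rV[R]_N) (w : R), [/\ 0 <= w <= 1,
  forall t, closure G (y t), y 0 = y T,
  forall t, 0 <= t <= T ->
    derivative_in T y t (w *: f t (y t) - (1 - w) *: (y t - p)) &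
  w < 1 -> exists2 t, 0 <= t <= T & ~ G (y t)].
Proof.
have [U [UU Uoo]] := @ultraFilterLemma nat \oo _.
have GA := @subset_closure _ G.
have cA : compact (closure G).
  by apply: bounded_closed_compact (bounded_set_closure bG) _; exact: closed_closure.
have [c1 c10 fc] := field_bounded hf cA GOmega.
have [c2 c20 xc] := bounded_set_norm_le (compact_bounded cA).
pose c3 := c2 + `|p|.
have c30 : 0 <= c3 by rewrite addr_ge0 // ltW.
have xpc x : closure G x -> `|x - p| <= c3.
  by move=> /xc h; apply: le_trans (ler_normB _ _) _; rewrite lerD2r.
(* The shift by [M] makes [h n <= 1], as the convex combination in the Euler step requires. *)
pose M := Num.truncn T; pose k n := (n + M)%N; pose h n := T / (k n).+1%:R.
have h0 n : 0 < h n by rewrite divr_gt0.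
have hK n : h n * (k n).+1%:R = T by rewrite divfK // pnatr_eq0.
have h1 n : h n <= 1.
  rewrite ler_pdivrMr // mul1r; have /andP[_ /ltW hT] := Num.Theory.truncn_itv (ltW T0).
  by apply: le_trans hT _; rewrite ler_nat ltnS leq_addl.
have hU : h @ U --> (0 : R).
  apply: (@cvg_harmonic_close R U UU Uoo T (fun=> 0)); first exact: cvg_cst.
  move=> n; rewrite subr0 gtr0_norm // ler_pM2l // lef_pV2 ?posrE //.
  by rewrite ler_nat ltnS leq_addr.
have fcc t x : 0 <= t <= T -> G x -> `|f t x + (x - p)| <= c1 + c3.
  move=> tT Gx; apply: le_trans (ler_normD _ _) _.
  by apply: lerD; [exact: fc (GA _ Gx)|exact: xpc (GA _ Gx)].
have fcvg (x : nat -> 'rV[R]_N) l t : 0 <= t <= T -> G l -> x @ U --> l ->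
    f t (x n) @[n --> U] --> f t l.
  by move=> tT Gl xl; apply: (field_cvg hf) => //; apply/GOmega/GA.
have step n := @discrete_periodic R U UU Uoo N G p T f (c1 + c3) (k n) (h n)
  n.+1%:R Gp (h0 n) (h1 n) (hK n) (ler0n _ _) (addr_ge0 (ltW c10) c30) fcc fcvg.
have [X hX] := choice step.
have [w hw] := choice hX.
have [w1 w1c wl] : exists2 l, `|l| <= 1 & w @ U --> l.
  apply: ultra_bounded_cvg => n; have [/andP[w0 w1] _ _ _ _] := hw n.
  by rewrite ger0_norm.
have w01 : 0 <= w1 <= 1.
  have w10 : 0 <= w1.
    by apply: (cvgr_to_ge wl); apply: nearW => n; have [/andP[]] := hw n.
  by rewrite w10 -(ger0_norm w10).
pose F n j := w n *: f (h n * j%:R) (X n j) - (1 - w n) *: (X n j - p).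
have tj n j : (j <= k n)%N -> 0 <= h n * j%:R <= T.
  move=> jk; rewrite mulr_ge0 ?(ltW (h0 n)) //= -(hK n) ler_pM2l //.
  by rewrite ler_nat leqW.
have XG n j : G (X n j) by have [_ _ hG] := hw n.
have XF n j : (j < (k n).+1)%N -> X n j.+1 - X n j = h n *: F n j.
  by have [_ _ _ hn _] := hw n; exact: hn.
have FC n j : (j < (k n).+1)%N -> `|F n j| <= c1 + c3 + c3.
  move=> jk; have [/andP[wn0 wn1] _ _ _ _] := hw n.
  have -> : F n j = w n *: (f (h n * j%:R) (X n j) + (X n j - p)) - (X n j - p).
    by apply/rowP => i; rewrite !mxE; ring.
  apply: le_trans (ler_normB _ _) _; apply: lerD; last exact: xpc (GA _ _).
  rewrite normrZ (ger0_norm wn0); apply: le_trans (fcc _ _ (tj _ _ jk) (XG n j)).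
  by rewrite ler_piMl.
have C0 : 0 <= c1 + c3 + c3 by rewrite !addr_ge0 // ltW.
have [y yA ylim] := @euler_limit R U N T _ UU C0 h (fun n => (k n).+1) X F
  (closure G) h0 hU hK XF FC cA (fun n j => GA _ (XG n j)).
have yidx s : 0 <= s <= T -> X n (node_index h n s) @[n --> U] --> y s.
  move=> sT; apply: ylim => // [n|]; first exact: (node_index_le h0 hK).
  by apply: (node_index_cvg UU h0 hU); case/andP: sT.
exists y, w1; split=> //.
- have y0 : X n 0%N @[n --> U] --> y 0.
    apply: ylim => //; first by rewrite lexx ltW.
    under eq_fun do rewrite mulr0; exact: cvg_cst.
  have yT : X n (k n).+1 @[n --> U] --> y T.
    apply: ylim => //; first by rewrite lexx ltW.
    under eq_fun do rewrite hK; exact: cvg_cst.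
  apply: norm_cvg_unique y0 _; rewrite /=.
  suff -> : (fun n => X n 0%N) = (fun n => X n (k n).+1) by [].
  by apply/funext => n; have [_ ->] := hw n.
- move=> t tT.
  apply: (euler_limit_derivative UU h0 hU hK XF tT yidx) => e e0.
  have e3 : 0 < e / 3 by rewrite divr_gt0.
  have [r r0 hr] := field_dist hf tT (GOmega (yA t)) e3.
  set C := c1 + c3 + c3 in FC C0 *.
  pose r' := Num.min r (e / 3).
  have r'0 : 0 < r' by rewrite lt_min r0.
  have rr : r' <= r by rewrite ge_min lexx.
  have re : r' <= e / 3 by rewrite ge_min lexx orbT.
  (* Nodes with time within [d] of [t] are at most [2 d] from the node before [t], so the Lipschitz
     bound costs [r' / 2]; another [r' / 4] is spent on the convergence to [y t]. *)
  pose d := Num.min r (r' / (4 * (C + 1))).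
  have d0 : 0 < d by rewrite lt_min r0 divr_gt0 // mulr_gt0 // ltr_wpDl.
  have dr : d <= r by rewrite ge_min lexx.
  have dC : C * d <= r' / 4.
    have : d <= r' / (4 * (C + 1)) by rewrite ge_min lexx orbT.
    by rewrite ler_pdivlMr ?mulr_gt0 ?ltr_wpDl //; nra.
  pose B := `|f t (y t) + (y t - p)|.
  exists d => //; near=> n => j jk jt.
  have hn : h n < d.
    by rewrite -[h n]gtr0_norm //; near: n; exact: cvgr0_norm_lt.
  have wn : `|w n - w1| * B <= e / 3.
    have : `|w n - w1| <= e / 3 / (B + 1).
      rewrite distrC; near: n; apply: cvgr_dist_le wl _ _.
      by rewrite divr_gt0 // ltr_wpDl /B.
    rewrite ler_pdivlMr ?ltr_wpDl /B //; have := normr_ge0 (w n - w1); nra.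
  have yn : `|X n (node_index h n t) - y t| < r' / 4.
    rewrite distrC; near: n; apply: cvgr_dist_lt; first exact: yidx.
    by rewrite divr_gt0.
  have xy : `|X n j - y t| < r'.
    have /andP[t0 _] := tT; have /andP[i1 i2] := node_index_bounds h0 n t0.
    have := euler_lipschitz h0 XF FC (node_index_le h0 hK n tT) (ltnW jk).
    set a := h n * j%:R in jt *; set b := h n * _ in i1 i2 *.
    have ab : `|a - b| <= 2 * d.
      by move: jt hn; rewrite ltr_norml ler_norml => /andP[? ?] ?;
        apply/andP; split; lra.
    have := ler_wpM2l C0 ab; have := ler_distD (X n (node_index h n t)) (X n j) (y t).
    lra.
  have [/andP[wn0 wn1] _ _ _ _] := hw n.
  (* Three errors of size [e / 3]: continuity of [f], convergence of the parameter, and closeness of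
     the node to [y t]. *)
  have -> : F n j - (w1 *: f t (y t) - (1 - w1) *: (y t - p)) =
      w n *: (f (h n * j%:R) (X n j) - f t (y t))
      + (w n - w1) *: (f t (y t) + (y t - p)) - (1 - w n) *: (X n j - y t).
    by apply/rowP => i; rewrite !mxE; ring.
  apply: le_trans (ler_normB _ _) _; apply: (@le_trans _ _ (e / 3 + e / 3 + e / 3)); last by lra.
  apply: lerD; last first.
    rewrite normrZ ger0_norm ?subr_ge0 //.
    have := normr_ge0 (X n j - y t); nra.
  apply: le_trans (ler_normD _ _) _; apply: lerD; last by rewrite normrZ.
  rewrite normrZ ger0_norm //.
  have /hr : 0 <= h n * j%:R <= T by exact: tj.
  move=> /(_ (X n j) (GOmega (GA _ (XG n j)))) hf3.
  apply: (@le_trans _ _ `|f (h n * j%:R) (X n j) - f t (y t)|); first by rewrite ler_piMl.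
  by apply: hf3; [exact: lt_le_trans dr|exact: lt_le_trans rr].
- move=> w1lt.
  have pick n : exists jz : nat * 'rV[R]_N, (jz.1 <= k n)%N /\ (w n < 1 ->
      ~ G jz.2 /\ n.+1%:R * `|X n jz.1 - jz.2| < 1).
    have [wn|wn] := ltP (w n) 1; last by exists (0%N, 0).
    by have [_ _ _ _ /(_ wn)[j [z [jk Gz hz]]]] := hw n; exists (j, z).
  have [jz hjz] := choice pick.
  have [t tT tU] : exists2 t, 0 <= t <= T & h n * (jz n).1%:R @[n --> U] --> t.
    have [||t tT tU] := @ultra_compact_cvg _ U R `[0, T] (fun n => h n * (jz n).1%:R) UU.
    - exact: segment_compact.
    - by apply: nearW => n /=; rewrite in_itv /= tj //; have [] := hjz n.
    - by exists t => //; move: tT; rewrite /= in_itv.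
  exists t => // Gt.
  have /nbhs_normP[r /= r0 hr] : nbhs (y t) G by exact: open_nbhs_nbhs.
  have Xt : X n (jz n).1 @[n --> U] --> y t.
    by apply: ylim => // n; have [/leqW] := hjz n.
  have r2 : 0 < r / 2 by rewrite divr_gt0.
  (* For such an [n], the point outside [G] is within [1 / (n + 1) < r / 2] of a node that is itself
     within [r / 2] of [y t], contradicting the ball of radius [r] in [G]. *)
  have [n [[wn Xn] hn]] : exists n,
      (w n < 1 /\ `|y t - X n (jz n).1| < r / 2) /\ n.+1%:R^-1 < r / 2.
    apply: (@filter_ex _ U); apply: filterI; first apply: filterI.
    - exact: cvgr_lt wl _ w1lt.
    - exact: cvgr_dist_lt Xt _ r2.
    - have h0U : n.+1%:R^-1 @[n --> U] --> (0 : R).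
        by move=> B /(@cvg_harmonic R); exact: Uoo.
      have : \forall n \near U, `|n.+1%:R^-1 : R| < r / 2 by apply: cvgr0_norm_lt.
      by apply: filterS => n /=; rewrite gtr0_norm.
  have [_ /(_ wn)[nG hz]] := hjz n; apply: nG; apply: hr.
  rewrite /ball_ /=; apply: le_lt_trans (ler_distD (X n (jz n).1) _ _) _.
  rewrite [ltRHS]splitr; apply: ltrD => //; apply: lt_trans hn.
  by rewrite -[ltRHS]mul1r ltr_pdivlMr // mulrC.
Unshelve. all: by end_near. Qed.
End Homotopy.

(** * Contact with the boundary excludes parameters below 1 *)

Unset Implicit Arguments.

Theorem theorem3p5 (R : realType) (N : nat) (T : R) (hT : 0 < T)
  (Omega : set 'rV[R]_N) (hOmega : open Omega) (hOmega0 : Omega !=set0)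
  (f : R -> 'rV[R]_N -> 'rV[R]_N)
  (hf : {within `[0, T]%classic `*` Omega,
           continuous (fun z : R * 'rV[R]_N => f z.1 z.2)})
  (G : set 'rV[R]_N) (hG : open G) (hGb : bounded_set G)
  (hGOmega : closure G `<=` Omega)
  (p : 'rV[R]_N) (delta : R) (hdelta : 0 < delta)
  (hball : eclosed_ball p delta `<=` G)
  (hstar : forall q, eclosed_ball p delta q -> closure_strictly_star_shaped G q)
  (hnormal : forall u, boundary G u ->
     exists2 nu, bony_normals (closure G) u nu &
       forall t : R, t \in `[0, T] -> inner (f t u) nu <= 0) :
  exists y : R -> 'rV[R]_N,
    [/\ forall t : R, t \in `[0, T] -> closure G (y t),
        ode_solution T f y & y 0 = y T].
Proof.
have Gp : G p.
  apply: hball; rewrite /eclosed_ball /= subrr /enorm /inner big1 ?sqrtr0 ?ltW //.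
  by move=> i _; rewrite mxE mul0r.
have [y [w [/andP[w0 w1] yG y0T dy touch]]] :=
  homotopy_solution hT hOmega hG hGb hGOmega Gp hf.
suff we : w = 1.
  exists y; split=> // t; rewrite in_itv /= => tT.
  apply: derivative_in_cvg; have := dy t tT.
  by rewrite we scale1r subrr scale0r subr0.
apply/eqP; rewrite eq_le w1 leNgt; apply/negP => wlt.
have [t tT nG] := touch wlt.
(* A contact at time 0 is moved to [T] by periodicity, because the viability argument looks backward
   in time. *)
have [s sT nGs] : exists2 s, 0 < s <= T & ~ G (y s).
  have [t0|t0] := eqVneq t 0; last by exists t => //; rewrite lt_def t0.
  by exists T; rewrite ?hT ?lexx // -y0T -t0.
have s0T : 0 <= s <= T by case/andP: sT => /ltW-> ->.
have bs : boundary G (y s) by split=> // /interior_subset.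
have [nu hnu fnu] := hnormal _ bs.
have := viable_derivative_bony sT (fun r _ => yG r) (dy s s0T) hnu.
have := bony_normal_ball hdelta hstar hnu bs.
have := fnu s; rewrite in_itv => /(_ s0T).
move=> a0 b0; rewrite innerDl innerNl !innerZl; nra.
Qed.
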